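(* There is an infinite $\Pi_1$ set (a subset of $\mathbb{N}$) that has no $\Pi_1$ r-cohesive subset but does have a $\Delta_2$ cohesive subset.
   Context: $\Pi_1$ and $\Delta_2$ refer to the arithmetical hierarchy of subsets of $\mathbb{N}$; c.e. means computably enumerable. For $X, Y \subseteq \mathbb{N}$, $X \subseteq^* Y$ means that $X \setminus Y$ is finite. A set $C \subseteq \mathbb{N}$ is cohesive if it is infinite and for every c.e. set $W$, either $C \subseteq^* W$ or $C \subseteq^* \mathbb{N} \setminus W$. A set $C \subseteq \mathbb{N}$ is r-cohesive if it is infinite and for every computable set $A \subseteq \mathbb{N}$, either $C \subseteq^* A$ or $C \subseteq^* \mathbb{N} \setminus A$. *)

(* Defs.v *)
From mathcomp Require Import all_boot.
From mathcomp Require Import classical_sets cardinality.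
From Stdlib Require Import Arith.Cantor.
Set Implicit Arguments.
Unset Strict Implicit.
Unset Printing Implicit Defensive.
Local Open Scope classical_set_scope.

(* Partial recursive functions are presented as unary functions, with several
   arguments (and the operations of primitive recursion and minimization)
   passed through the Cantor bijection of nat * nat with nat. *)

Definition cpair (x y : nat) : nat := Cantor.to_nat (x, y).
Definition cfst (n : nat) : nat := (Cantor.of_nat n).1.
Definition csnd (n : nat) : nat := (Cantor.of_nat n).2.

Inductive code : Type :=
  | Zero
  | Succ
  | Fst
  | Snd
  | Pair of code & code
  | Comp of code & code
  | Prec of code & code
  | Mu of code.

(* Graph of h(a, 0) = f(a), h(a, k + 1) = g(a, (k, h(a, k))), given the graphs
   F and G of the partial functions f and g. *)
Fixpoint prec_graph (F G : nat -> nat -> Prop) (a k m : nat) : Prop :=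
  match k with
  | 0 => F a m
  | k'.+1 => exists2 b, prec_graph F G a k' b & G (cpair a (cpair k' b)) m
  end.

(* Graph of a |-> the least k with f(a, k) = 0, where f(a, i) must be defined
   for every i < k. *)
Definition mu_graph (F : nat -> nat -> Prop) (a k : nat) : Prop :=
  F (cpair a k) 0 /\ forall i, i < k -> exists v, F (cpair a i) v.+1.

(* eval c n m: the partial function coded by c is defined at n with value m. *)
Fixpoint eval (c : code) (n m : nat) : Prop :=
  match c with
  | Zero => m = 0
  | Succ => m = n.+1
  | Fst => m = cfst n
  | Snd => m = csnd n
  | Pair f g => exists u v, [/\ eval f n u, eval g n v & m = cpair u v]
  | Comp f g => exists2 u, eval g n u & eval f u m
  | Prec f g => prec_graph (eval f) (eval g) (cfst n) (csnd n) m
  | Mu f => mu_graph (eval f) n m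
  end.

Definition computable (A : set nat) : Prop :=
  exists c : code, forall n, (A n -> eval c n 1) /\ (~ A n -> eval c n 0).

Definition ce (A : set nat) : Prop :=
  exists c : code, forall n, A n <-> exists m, eval c n m.

Fixpoint Sigma_set (n : nat) (A : set nat) : Prop :=
  match n with
  | 0 => computable A
  | k.+1 => exists2 B, Pi_set k B & forall x, A x <-> exists y, B (cpair x y)
  end
with Pi_set (n : nat) (A : set nat) : Prop :=
  match n with
  | 0 => computable A
  | k.+1 => exists2 B, Sigma_set k B & forall x, A x <-> forall y, B (cpair x y)
  end.

Definition Delta_set (n : nat) (A : set nat) : Prop :=
  Sigma_set n A /\ Pi_set n A.

Definition almost_subset (X Y : set nat) : Prop := finite_set (X `\` Y).

Definition cohesive (C : set nat) : Prop :=
  infinite_set C /\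
  forall W, ce W -> almost_subset C W \/ almost_subset C (~` W).

Definition r_cohesive (C : set nat) : Prop :=
  infinite_set C /\
  forall A, computable A -> almost_subset C A \/ almost_subset C (~` A).

(* Main.v *)
(* Split the numbers <x, s> with s < 2 ^ x into blocks indexed by x, and let
   W_0, W_1, ... enumerate the c.e. sets.

   A is obtained by evicting points from the blocks.  For each e < x, as soon as
   W_e covers one of the two halves { s | bit e of s = b } of block x (but not
   the other half), the other half is evicted.  The requirements act on distinct
   bits, so every block keeps a point.  If C is a Pi_1 subset of A with
   complement W_e, a block x > e that meets C meets it in both halves for e:
   otherwise W_e covers one half, and then what remains of the block lies in
   W_e.  So an infinite C is split by the computable set of the <x, s> whose bit
   e of s is 1.

   Any such A, Pi_1 and meeting every block, has a Delta_2 cohesive subset.  The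
   n-state of v is the binary number with digits
   [v in W_0], ..., [v in W_(n-1)].
   The least n-state among the remaining points of a block only increases with
   the stage, because both the eviction and the states increase.  Hence "block x
   has state at least k" is Sigma_1, and 0' finds for each n the first block
   x >= n of maximal n-state together with its points realizing that state.
   As n grows, the maximum over x >= n of the e-states decreases, so it is
   eventually constant, and the chosen points form a cohesive set. *)
Require Import Defs.
From mathcomp Require Import all_boot.
From mathcomp Require Import boolp classical_sets cardinality.
Local Open Scope classical_set_scope.

(** * Cantor pairing and single-valuedness of evaluation *)

Arguments cpair : simpl never.
Arguments cfst : simpl never.
Arguments csnd : simpl never.

Lemma cfst_pair x y : cfst (cpair x y) = x.
Proof. by rewrite /cfst /cpair Cantor.cancel_of_to. Qed.

Lemma csnd_pair x y : csnd (cpair x y) = y.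
Proof. by rewrite /csnd /cpair Cantor.cancel_of_to. Qed.

Lemma cpair_surj n : cpair (cfst n) (csnd n) = n.
Proof. by rewrite /cpair /cfst /csnd -surjective_pairing Cantor.cancel_to_of. Qed.

Definition cpairE := (cfst_pair, csnd_pair).

Lemma eval_fun c n m1 m2 : eval c n m1 -> eval c n m2 -> m1 = m2.
Proof.
elim: c n m1 m2 => [||||f IHf g IHg|f IHf g IHg|f IHf g IHg|f IHf] n m1 m2 /=;
  try by move=> -> ->.
- move=> [u [v [fu gv ->]]] [u' [v' [fu' gv' ->]]].
  by rewrite (IHf _ _ _ fu fu') (IHg _ _ _ gv gv').
- move=> [u gu fu] [u' gu' fu'].
  by rewrite (IHg _ _ _ gu gu') in fu; exact: IHf fu fu'.
- move: (cfst n) (csnd n) => a k.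
  elim: k m1 m2 => [|k IHk] m1 m2 /=; first exact: IHf.
  move=> [b pb gb] [b' pb' gb'].
  by rewrite (IHk _ _ pb pb') in gb; exact: IHg gb gb'.
(* At the smaller of two distinct results, [f] would take both the value 0 and a successor value. *)
- move=> [z1 p1] [z2 p2]; case: (ltngtP m1 m2) => // lt.
  + by have [v /(IHf _ _ _ z1)] := p2 _ lt.
  + by have [v /(IHf _ _ _ z2)] := p1 _ lt.
Qed.

(** * Computable functions *)

(** Truth values enter through the coercion of [bool] to [nat], so [recf] also expresses
    decidability of predicates. *)
Definition recf (f : nat -> nat) : Prop :=
  exists c, forall n m, eval c n m <-> m = f n.

Lemma recf_ext f g : f =1 g -> recf f -> recf g.
Proof. by move=> fg [c cP]; exists c => n m; rewrite cP fg. Qed.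

Lemma recf_comp f g : recf f -> recf g -> recf (fun n => f (g n)).
Proof.
move=> [c cP] [d dP]; exists (Comp c d) => n m /=; split.
  by move=> [u /dP -> /cP].
by move=> ->; exists (g n); [apply/dP|apply/cP].
Qed.

Lemma recf_pair f g : recf f -> recf g -> recf (fun n => cpair (f n) (g n)).
Proof.
move=> [c cP] [d dP]; exists (Pair c d) => n m /=; split.
  by move=> [u [v [/cP -> /dP -> ->]]].
by move=> ->; exists (f n), (g n); split=> //; [apply/cP|apply/dP].
Qed.

Lemma recf_fst f : recf f -> recf (fun n => cfst (f n)).
Proof. by apply: recf_comp; exists Fst. Qed.

Lemma recf_snd f : recf f -> recf (fun n => csnd (f n)).
Proof. by apply: recf_comp; exists Snd. Qed.

Lemma recf_succ f : recf f -> recf (fun n => (f n).+1).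
Proof. by apply: (recf_comp S); exists Succ. Qed.

(** [code] has no identity constructor; the identity is the pairing of the two projections. *)
Lemma recf_id : recf (fun n => n).
Proof.
apply: (recf_ext (fun n => cpair (cfst n) (csnd n))); first exact: cpair_surj.
by apply: recf_pair; [exists Fst|exists Snd].
Qed.

Lemma recf_const k : recf (fun=> k).
Proof. by elim: k => [|k]; [exists Zero|exact: recf_succ]. Qed.

Definition prec (a : nat) (h : nat -> nat -> nat) (k : nat) : nat :=
  nat_rect (fun=> nat) a h k.

(** The whole input [n] serves as the parameter of [Prec], so the step function may depend on it. *)
Lemma recf_prec f h b :
  recf f -> recf b ->
  recf (fun p => h (cfst p) (cfst (csnd p)) (csnd (csnd p))) ->
  recf (fun n => prec (f n) (h n) (b n)).
Proof.
move=> [c cP] [d dP] [e eP].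
have [i iP] := recf_id.
exists (Comp (Prec c e) (Pair i d)) => n m /=.
suff H k r : prec_graph (eval c) (eval e) n k r <-> r = prec (f n) (h n) k.
  split.
    by move=> [u [x [y [/iP -> /dP -> ->]]]]; rewrite !cpairE => /H.
  move=> ->; exists (cpair n (b n)); last by rewrite !cpairE; apply/H.
  by exists n, (b n); split=> //; [apply/iP|apply/dP].
elim: k r => [|k IHk] r /=; first exact: cP.
split; first by move=> [x /IHk -> /eP]; rewrite !cpairE.
by move=> ->; exists (prec (f n) (h n) k); [apply/IHk|apply/eP; rewrite !cpairE].
Qed.

(* Extension point for recf_tac: rebound below as more closure lemmas appear. *)
Ltac recf_user := fail.

Ltac recf_step :=
  lazymatch goal with
  | |- recf (fun n => n) => exact: recf_id
  | |- recf cfst => by exists Fst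
  | |- recf csnd => by exists Snd
  | |- recf (fun=> ?k) => exact: recf_const
  | |- recf (fun n => cpair (@?f n) (@?g n)) => apply: (recf_pair f g)
  | |- recf (fun n => cfst (@?f n)) => apply: (recf_fst f)
  | |- recf (fun n => csnd (@?f n)) => apply: (recf_snd f)
  | |- recf (fun n => (@?f n).+1) => apply: (recf_succ f)
  | |- recf (fun n => prec (@?f n) (fun k r => @?h n k r) (@?b n)) =>
      apply: (recf_prec f h b)
  | |- _ => first
      [ match goal with
        | H : recf ?f |- recf ?f => exact: H
        | H : recf ?f |- recf (fun n => ?f (@?h n)) => apply: (recf_comp f h H)
        | H : recf (fun n => nat_of_bool (?f n))
          |- recf (fun n => nat_of_bool (?f (@?h n))) =>
            apply: (recf_comp (fun n => nat_of_bool (f n)) h H)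
        end
      | progress recf_user ]
  end.

Ltac recf_tac := repeat (cbv beta; recf_step).

Lemma recf_add f g : recf f -> recf g -> recf (fun n => f n + g n).
Proof.
move=> rf rg; apply: (recf_ext (fun n => prec (f n) (fun _ r => r.+1) (g n))).
  by move=> n; elim: (g n) => [|k /= ->]; rewrite ?addn0 ?addnS.
recf_tac.
Qed.

Lemma recf_mul f g : recf f -> recf g -> recf (fun n => f n * g n).
Proof.
move=> rf rg.
apply: (recf_ext (fun n => prec 0 (fun _ r => r + f n) (g n))).
  by move=> n; elim: (g n) => [|k /= ->]; rewrite ?muln0 // mulnSr.
recf_tac; apply: recf_add; recf_tac.
Qed.

Lemma recf_exp f g : recf f -> recf g -> recf (fun n => f n ^ g n).
Proof.
move=> rf rg.
apply: (recf_ext (fun n => prec 1 (fun _ r => f n * r) (g n))).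
  by move=> n; elim: (g n) => [|k /= ->]; rewrite ?expn0 // expnS.
recf_tac; apply: recf_mul; recf_tac.
Qed.

Lemma recf_sub f g : recf f -> recf g -> recf (fun n => f n - g n).
Proof.
move=> rf rg.
(* The inner [prec] is the predecessor of [r], with value 0 at 0. *)
apply: (recf_ext (fun n => prec (f n) (fun _ r => prec 0 (fun k _ => k) r) (g n))).
  move=> n; elim: (g n) => [|k /= ->]; rewrite ?subn0 // subnS.
  by case: (f n - k).
recf_tac.
Qed.

Lemma recf_leq f g : recf f -> recf g -> recf (fun n => f n <= g n).
Proof.
move=> rf rg.
apply: (recf_ext (fun n => prec 1 (fun _ _ => 0) (f n - g n))).
  by move=> n; rewrite /leq; case: (f n - g n).
recf_tac; exact: recf_sub.
Qed.

Lemma recf_neg (p : nat -> bool) : recf (fun n => p n) -> recf (fun n => ~~ p n).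
Proof.
move=> rp; apply: (recf_ext (fun n => prec 1 (fun _ _ => 0) (p n))).
  by move=> n; case: (p n).
recf_tac.
Qed.

Lemma recf_and (p q : nat -> bool) :
  recf (fun n => p n) -> recf (fun n => q n) -> recf (fun n => p n && q n).
Proof.
move=> rp rq; apply: (recf_ext (fun n => p n * q n)); last exact: recf_mul.
by move=> n; case: (p n); case: (q n).
Qed.

Lemma recf_or (p q : nat -> bool) :
  recf (fun n => p n) -> recf (fun n => q n) -> recf (fun n => p n || q n).
Proof.
move=> rp rq; apply: (recf_ext (fun n => ~~ (~~ p n && ~~ q n))).
  by move=> n; case: (p n); case: (q n).
by apply: recf_neg; apply: recf_and; apply: recf_neg.
Qed.

Lemma recf_imp (p q : nat -> bool) :
  recf (fun n => p n) -> recf (fun n => q n) -> recf (fun n => p n ==> q n).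
Proof.
move=> rp rq; apply: (recf_ext (fun n => ~~ p n || q n)).
  by move=> n; rewrite implybE.
by apply: recf_or => //; apply: recf_neg.
Qed.

Lemma recf_eqn f g : recf f -> recf g -> recf (fun n => f n == g n).
Proof.
move=> rf rg; apply: (recf_ext (fun n => (f n <= g n) && (g n <= f n))).
  by move=> n; rewrite eqn_leq.
by apply: recf_and; apply: recf_leq.
Qed.

Lemma recf_eqb (p q : nat -> bool) :
  recf (fun n => p n) -> recf (fun n => q n) -> recf (fun n => p n == q n).
Proof.
move=> rp rq; apply: (recf_ext (fun n => (p n : nat) == q n)).
  by move=> n; case: (p n); case: (q n).
exact: recf_eqn.
Qed.

Lemma recf_all (p : nat -> nat -> bool) b :
  recf b -> recf (fun x => p (cfst x) (csnd x)) ->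
  recf (fun n => all (p n) (iota 0 (b n))).
Proof.
move=> rb rp.
apply: (recf_ext (fun n => prec 1 (fun k r => r * p n k) (b n))).
  move=> n; elim: (b n) => // k IHk.
  have -> : iota 0 k.+1 = iota 0 k ++ [:: k] by rewrite -addn1 iotaD.
  by rewrite all_cat /= IHk andbT; case: all; case: (p n k).
recf_tac; apply: recf_mul; recf_tac.
apply: (recf_ext (fun x => p (cfst (cpair (cfst x) (cfst (csnd x))))
                            (csnd (cpair (cfst x) (cfst (csnd x)))))).
  by move=> x; rewrite !cpairE.
by apply: (recf_comp (fun x => p (cfst x) (csnd x))) => //; recf_tac.
Qed.

Lemma recf_has (p : nat -> nat -> bool) b :
  recf b -> recf (fun x => p (cfst x) (csnd x)) ->
  recf (fun n => has (p n) (iota 0 (b n))).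
Proof.
move=> rb rp.
apply: (recf_ext (fun n => ~~ all (fun k => ~~ p n k) (iota 0 (b n)))).
  move=> n; rewrite -has_predC; congr nat_of_bool.
  by apply: eq_has => k /=; rewrite negbK.
by apply/recf_neg/(recf_all (fun n k => ~~ p n k)) => //; apply: recf_neg.
Qed.

Lemma recf_odd f : recf f -> recf (fun n => odd (f n)).
Proof.
move=> rf; apply: (recf_ext (fun n => prec 0 (fun _ r => 1 - r) (f n))).
  by move=> n; elim: (f n) => //= k ->; case: odd.
recf_tac; apply: recf_sub; recf_tac.
Qed.

Lemma recf_half f : recf f -> recf (fun n => (f n)./2).
Proof.
move=> rf; apply: (recf_ext (fun n => prec 0 (fun k r => odd k + r) (f n))).
  by move=> n; elim: (f n) => //= k ->; rewrite uphalf_half.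
recf_tac; apply: recf_add; recf_tac; apply: recf_odd; recf_tac.
Qed.

Lemma recf_iter h f b :
  recf h -> recf f -> recf b -> recf (fun n => iter (b n) h (f n)).
Proof.
move=> rh rf rb; apply: (recf_ext (fun n => prec (f n) (fun _ r => h r) (b n))).
  by move=> n; elim: (b n) => //= k ->.
recf_tac.
Qed.

Definition bit (s e : nat) : bool := odd (iter e half s).

Lemma recf_bit f g : recf f -> recf g -> recf (fun n => bit (f n) (g n)).
Proof.
by move=> rf rg; apply/recf_odd/recf_iter => //; apply: recf_half; recf_tac.
Qed.

Ltac recf_arith :=
  lazymatch goal with
  | |- recf (fun n => @?f n + @?g n) => apply: (recf_add f g)
  | |- recf (fun n => @?f n - @?g n) => apply: (recf_sub f g)
  | |- recf (fun n => @?f n * @?g n) => apply: (recf_mul f g)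
  | |- recf (fun n => @?f n ^ @?g n) => apply: (recf_exp f g)
  | |- recf (fun n => (@?f n)./2) => apply: (recf_half f)
  | |- recf (fun n => iter (@?b n) ?h (@?f n)) => apply: (recf_iter h f b)
  | |- recf (fun n => nat_of_bool (@?f n <= @?g n)) => apply: (recf_leq f g)
  | |- recf (fun n => nat_of_bool (~~ @?p n)) => apply: (recf_neg p)
  | |- recf (fun n => nat_of_bool (@?p n && @?q n)) => apply: (recf_and p q)
  | |- recf (fun n => nat_of_bool (@?p n || @?q n)) => apply: (recf_or p q)
  | |- recf (fun n => nat_of_bool (@?p n ==> @?q n)) => apply: (recf_imp p q)
  | |- recf (fun n => nat_of_bool (@eq_op _ (@?f n) (@?g n))) =>
      first [apply: (recf_eqn f g) | apply: (recf_eqb f g)]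
  | |- recf (fun n => nat_of_bool (odd (@?f n))) => apply: (recf_odd f)
  | |- recf (fun n => nat_of_bool (bit (@?f n) (@?g n))) => apply: (recf_bit f g)
  | |- recf (fun n => nat_of_bool (all (fun i => @?p n i) (iota 0 (@?b n)))) =>
      apply: (recf_all p b)
  | |- recf (fun n => nat_of_bool (has (fun i => @?p n i) (iota 0 (@?b n)))) =>
      apply: (recf_has p b)
  end.

Ltac recf_user ::= recf_arith.

(** * Universal c.e. set *)

Fixpoint num (c : code) : nat :=
  match c with
  | Zero => cpair 0 0
  | Succ => cpair 1 0
  | Fst => cpair 2 0
  | Snd => cpair 3 0
  | Pair f g => cpair 4 (cpair (num f) (num g))
  | Comp f g => cpair 5 (cpair (num f) (num g))
  | Prec f g => cpair 6 (cpair (num f) (num g))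
  | Mu f => cpair 7 (num f)
  end.

(* The triple <c, n, m> stands for the statement that code c maps n to m. *)
Definition trip (c n m : nat) : nat := cpair c (cpair n m).

Definition value (t : nat) : nat := csnd (csnd t).

(* The statement t follows in one step of evaluation from statements in l. *)
Definition just (l : seq nat) (t : nat) : bool :=
  let c := cfst t in let n := cfst (csnd t) in let m := value t in
  let f := cfst (csnd c) in let g := csnd (csnd c) in
  let a := cfst n in let k := csnd n in
  (cfst c == 0) && (m == 0) ||
  (cfst c == 1) && (m == n.+1) ||
  (cfst c == 2) && (m == cfst n) ||
  (cfst c == 3) && (m == csnd n) ||
  (cfst c == 4) && (has (fun t' => t' == trip f n (cfst m)) l
                    && has (fun t' => t' == trip g n (csnd m)) l) ||
  (cfst c == 5) && has (fun t' => (t' == trip g n (value t'))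
                    && has (fun t'' => t'' == trip f (value t') m) l) l ||
  (cfst c == 6) && (k == 0) && has (fun t' => t' == trip f a m) l ||
  (cfst c == 6) && (1 <= k) &&
    has (fun t' => (t' == trip c (cpair a (k - 1)) (value t')) &&
      has (fun t'' => t'' == trip g (cpair a (cpair (k - 1) (value t'))) m) l) l ||
  (cfst c == 7) && has (fun t' => t' == trip (csnd c) (cpair n m) 0) l &&
    all (fun i => has (fun t' => (t' == trip (csnd c) (cpair n i) (value t'))
                    && (1 <= value t')) l) (iota 0 m).

(** A trace is written in reverse: each statement is justified by those after it, which excludes
    circular justifications. *)
Fixpoint valid (l : seq nat) : bool :=
  if l is t :: l' then just l' t && valid l' else true.

Lemma hasP1 (t : nat) (l : seq nat) : reflect (t \in l) (has (fun t' => t' == t) l).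
Proof. by rewrite (_ : has _ _ = (t \in l)) ?has_pred1 //; exact: idP. Qed.

(** By induction on the trace; the tags in [num] single out the clauses of [just] that belong to the
    constructor of [c]. *)
Lemma valid_sound l c n m : valid l -> trip (num c) n m \in l -> eval c n m.
Proof.
elim: l c n m => // t l IH c n m /= /andP[jt vl]; rewrite inE.
case/orP; last exact: IH.
move=> /eqP E; move: jt; subst t; rewrite /just /trip /value !cpairE.
case: c => [||||f g|f g|f g|f] /=; rewrite ?cpairE /= ?orbF ?andbT /=.
- by move/eqP.
- by move/eqP.
- by move/eqP.
- by move/eqP.
- move=> /andP[/hasP1 h1 /hasP1 h2]; exists (cfst m), (csnd m).
  by split; rewrite ?cpair_surj //; exact: IH.
- move=> /hasP[t tl /andP[/eqP E /hasP1 h]]; rewrite {1}E in tl.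
  by exists (csnd (csnd t)); exact: IH.
- case/orP.
    by move=> /andP[/eqP -> /hasP1 h] /=; exact: IH.
  move=> /andP[k0 /hasP[t tl /andP[/eqP E /hasP1 h]]]; rewrite {1}E in tl.
  case: (csnd n) k0 tl h => // k _; rewrite subn1 /= => tl h.
  exists (csnd (csnd t)); last exact: IH.
  by have := IH (Prec f g) _ _ vl tl; rewrite /= !cpairE.
- move=> /andP[/hasP1 h /allP ha]; split; first exact: IH.
  move=> i im; have := ha i; rewrite mem_iota im => /(_ isT) /hasP[t tl].
  move=> /andP[/eqP E v0]; exists (csnd (csnd t)).-1.
  by rewrite prednK //; apply: IH => //; rewrite /trip -E.
Qed.

(** Starting from an arbitrary [l] lets the traces of subcomputations be stacked, with earlier
    conclusions still available. *)
Lemma valid_extend c n m l : eval c n m -> valid l ->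
  exists l', [/\ valid l', {subset l <= l'} & trip (num c) n m \in l'].
Proof.
have add (l0 l1 : seq nat) t : {subset l0 <= l1} -> valid l1 -> just l1 t ->
    exists l', [/\ valid l', {subset l0 <= l'} & t \in l'].
  move=> s v j; exists (t :: l1); rewrite /= j v mem_head; split=> // u /s.
  by rewrite inE orbC => ->.
elim: c n m l => [||||f IHf g IHg|f IHf g IHg|f IHf g IHg|f IHf] n m l /=.
1-4: by move=> -> vl; apply: (add l l) => //;
  rewrite /just /trip /value !cpairE ?eqxx ?orbT.
- move=> [u [v [fu gv ->]]] /(IHf _ _ _ fu) [l1 [v1 s1 t1]].
  have [l2 [v2 s2 t2]] := IHg _ _ _ gv v1.
  apply: (add l l2) => //; first by move=> x /s1 /s2.
  rewrite /just /trip /value !cpairE /=.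
  by do ![apply/orP; left]; apply/andP; split; apply/hasP1 => //; exact: s2.
- move=> [u gu fu] /(IHg _ _ _ gu) [l1 [v1 s1 t1]].
  have [l2 [v2 s2 t2]] := IHf _ _ _ fu v1.
  apply: (add l l2) => //; first by move=> x /s1 /s2.
  rewrite /just /trip /value !cpairE /= !orbF.
  apply/hasP; exists (trip (num g) n u); first exact: s2.
  by rewrite /trip !cpairE eqxx; apply/hasP1.
- rewrite -{3}(cpair_surj n); move: (cfst n) (csnd n) => a k.
  elim: k m l => [|k IHk] m l /=.
    move=> fm /(IHf _ _ _ fm) [l1 [v1 s1 t1]]; apply: (add l l1) => //.
    rewrite /just /trip /value !cpairE /= !orbF.
    by apply/hasP1.
  move=> [b pb gm] /(IHk _ _ pb) [l1 [v1 s1 t1]].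
  have [l2 [v2 s2 t2]] := IHg _ _ _ gm v1.
  apply: (add l l2) => //; first by move=> x /s1 /s2.
  rewrite /just /trip /value !cpairE /= !orbF subn1 /=.
  apply/hasP; exists (trip (num (Prec f g)) (cpair a k) b); first exact: s2.
  by rewrite /trip !cpairE eqxx; apply/hasP1.
- move=> [f0 fi] /(IHf _ _ _ f0) [l1 [v1 s1 t1]].
  have [l2 [v2 s2 t2]] : exists l2, [/\ valid l2, {subset l1 <= l2} &
      forall i, i < m -> exists v, trip (num f) (cpair n i) v.+1 \in l2].
    elim: m {f0 t1} fi => [|k IHk] fi; first by exists l1; split.
    have [|l2 [v2 s2 t2]] := IHk; first by move=> i ik; apply: fi; exact: leqW.
    have [v fv] := fi k (ltnSn k); have [l3 [v3 s3 t3]] := IHf _ _ _ fv v2.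
    exists l3; split=> //; first by move=> x /s2 /s3.
    move=> i; rewrite ltnS leq_eqVlt => /predU1P[->|/t2[w /s3 h]]; first by exists v.
    by exists w.
  apply: (add l l2) => //; first by move=> x /s1 /s2.
  rewrite /just /trip /value !cpairE /=; apply/andP; split.
    by apply/hasP1/s2.
  apply/allP => i; rewrite mem_iota => /t2[v h].
  by apply/hasP; exists (trip (num f) (cpair n i) v.+1); rewrite // /trip !cpairE eqxx.
Qed.

(** Every number decodes to an endless list, so the length is supplied separately. *)
Definition dec (L s : nat) : seq nat :=
  [seq cfst (iter j csnd s) | j <- iota 0 L].

Lemma decS L s : dec L.+1 s = cfst s :: dec L (csnd s).
Proof.
rewrite /dec /= -[1]/(1 + 0) iotaDl -map_comp; congr cons.
by apply: eq_map => j /=; rewrite -iterSr.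
Qed.

Lemma dec_surj l : exists s, dec (size l) s = l.
Proof.
elim: l => [|t l [s ds]]; first by exists 0.
by exists (cpair t s); rewrite /= decS !cpairE ds.
Qed.

(** This turns the recursion into a bounded quantifier over positions, to which [recf_all]
    applies. *)
Lemma valid_dec L s : valid (dec L s) =
  all (fun i => just (dec (L - i.+1) (iter i.+1 csnd s)) (cfst (iter i csnd s)))
    (iota 0 L).
Proof.
elim: L s => // L IH s; rewrite decS /= IH subSS subn0; congr andb.
rewrite -[1]/(1 + 0) iotaDl all_map; apply: eq_all => i /=.
by rewrite subSS -!iterSr.
Qed.

Lemma recf_has_dec (p : nat -> nat -> bool) h s :
  recf h -> recf s -> recf (fun x => p (cfst x) (csnd x)) ->
  recf (fun n => has (p n) (dec (h n) (s n))).
Proof.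
move=> rh rs rp.
apply: (recf_ext (fun n =>
    has (fun j => p n (cfst (iter j csnd (s n)))) (iota 0 (h n)))).
  by move=> n; rewrite /dec has_map.
recf_tac.
pose u x := cpair (cfst x) (cfst (iter (csnd x) csnd (s (cfst x)))).
apply: (recf_ext (fun x => p (cfst (u x)) (csnd (u x)))).
  by move=> x; rewrite /u !cpairE.
apply: (recf_comp (fun x => p (cfst x) (csnd x)) u) => //; rewrite /u; recf_tac.
Qed.

Ltac recf_trace :=
  lazymatch goal with
  | |- recf (fun n => nat_of_bool (has (fun t => @?p n t) (dec (@?h n) (@?s n)))) =>
      apply: (recf_has_dec p h s)
  | |- _ => recf_arith
  end.

Ltac recf_user ::= recf_trace.

Lemma recf_just f h s : recf f -> recf h -> recf s ->
  recf (fun n => just (dec (h n) (s n)) (f n)).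
Proof.
move=> rf rh rs; rewrite /just /trip /value /=.
recf_tac.
Qed.

Lemma recf_valid_dec h s : recf h -> recf s ->
  recf (fun n => valid (dec (h n) (s n))).
Proof.
move=> rh rs.
apply: (recf_ext (fun n => all (fun i => just (dec (h n - i.+1)
    (iter i.+1 csnd (s n))) (cfst (iter i csnd (s n)))) (iota 0 (h n)))) => [n|].
  by rewrite valid_dec.
by recf_tac; apply: recf_just; recf_tac.
Qed.

(* Stage t of the c.e. set { n | exists y, eval c (cpair n y) 0 } for e = num c:
   w codes a trace of length cfst w, followed by y. This form serves both
   complements of Pi_1 sets and domains of codes. *)
Definition W (e t n : nat) : bool :=
  has (fun w => valid (dec (cfst w) (cfst (csnd w))) &&
     has (fun t' => t' == trip e (cpair n (csnd (csnd w))) 0)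
       (dec (cfst w) (cfst (csnd w)))) (iota 0 t).

Lemma recf_W f g h : recf f -> recf g -> recf h ->
  recf (fun n => W (f n) (g n) (h n)).
Proof.
move=> rf rg rh; rewrite /W /trip; recf_tac.
by apply: recf_valid_dec; recf_tac.
Qed.

Lemma W_mono e n t t' : t <= t' -> W e t n -> W e t' n.
Proof.
move=> tt /hasP[w]; rewrite mem_iota => wt h; apply/hasP; exists w => //.
by rewrite mem_iota (leq_trans wt tt).
Qed.

Lemma WP c n : (exists t, W (num c) t n) <-> exists y, eval c (cpair n y) 0.
Proof.
split=> [[t /hasP[w _ /andP[v /hasP1 h]]]|[y ey]].
  by exists (csnd (csnd w)); exact: valid_sound v h.
have [l [vl _ tl]] := valid_extend _ _ _ [::] ey isT.
have [s ds] := dec_surj l.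
(* The stage is one above the witness because [W] searches strictly below it. *)
exists (cpair (size l) (cpair s y)).+1; apply/hasP.
exists (cpair (size l) (cpair s y)); first by rewrite mem_iota add0n leqnn.
by rewrite !cpairE ds vl; apply/hasP1.
Qed.

(** * Bounded quantifiers, common stages and indices *)

Lemma all_iotaP (p : nat -> bool) n :
  reflect (forall i, i < n -> p i) (all p (iota 0 n)).
Proof. by apply: (iffP allP) => h i; have := h i; rewrite mem_iota. Qed.

Lemma has_iotaP (p : nat -> bool) n :
  reflect (exists2 i, i < n & p i) (has p (iota 0 n)).
Proof.
by apply: (iffP hasP) => -[i]; rewrite ?mem_iota => ? ?; exists i;
  rewrite ?mem_iota.
Qed.

Lemma common_stage (p : nat -> nat -> bool) n :
  (forall i t t', t <= t' -> p i t -> p i t') ->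
  (forall i, i < n -> exists t, p i t) -> exists t, forall i, i < n -> p i t.
Proof.
move=> mono; elim: n => [|n IH] h; first by exists 0.
have [|t ht] := IH; first by move=> i lt; apply: h; exact: ltnW.
have [t' ht'] := h n (ltnSn n).
exists (maxn t t') => i; rewrite ltnS leq_eqVlt => /predU1P[->|/ht].
  by apply: mono ht'; exact: leq_maxr.
by apply: mono; exact: leq_maxl.
Qed.

(** The bits below [x] can be prescribed independently, so one point of block [x] can satisfy all
    its requirements. *)
Lemma exists_bits (f : nat -> bool) x :
  exists2 s, s < 2 ^ x & forall e, e < x -> bit s e = f e.
Proof.
elim: x f => [|x IH] f; first by exists 0.
have [s lt sE] := IH (fun e => f e.+1).
exists (f 0 + s.*2).
  by rewrite expnS mul2n -ltn_half_double half_bit_double.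
case=> [_|e /sE]; first by rewrite /bit /= oddD odd_double addbF oddb.
by rewrite /bit iterSr half_bit_double.
Qed.

Lemma recf_computable (p : nat -> bool) : recf p -> computable [set n | p n].
Proof. by move=> [c cP]; exists c => n; split=> /=; rewrite cP; case: (p n). Qed.

Lemma Pi1_complement C : Pi_set 1 C ->
  exists e, forall n, ~ C n <-> exists t, W e t n.
Proof.
move=> [B [c cP] CB]; exists (num c) => n; rewrite WP CB; split.
  by move=> /existsNP[y nB]; exists y; apply/(cP _).2.
move=> [y e0] /(_ y)/(cP _).1 e1; by have := eval_fun _ _ _ _ e0 e1.
Qed.

Lemma ce_index V : ce V -> exists e, forall n, V n <-> exists t, W e t n.
Proof.
(* This code ignores the second component and returns 0 exactly where [c] halts on the first. *)
move=> [c cP]; exists (num (Comp Zero (Comp c Fst))) => n; rewrite WP cP.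
split=> [[m cm]|[y [u [z -> cz] _]]]; last by exists u; rewrite cfst_pair in cz.
by exists 0, m => //=; exists n; rewrite // cfst_pair.
Qed.

(** * The Pi_1 set *)

Definition covers (e : nat) (b : bool) (x t : nat) : bool :=
  all (fun s => (bit s e == b) ==> W e t (cpair x s)) (iota 0 (2 ^ x)).

(* As covers increases with t, at most one of the two values of bit e is
   evicted; if both halves get covered at the same stage, neither is. *)
Definition evict (v t : nat) : bool :=
  has (fun e => covers e (~~ bit (csnd v) e) (cfst v) t &&
             ~~ covers e (bit (csnd v) e) (cfst v) t) (iota 0 (cfst v)).

Definition evicted (v t : nat) : bool := has (fun t' => evict v t') (iota 0 t).

Definition remaining : set nat :=
  [set v | csnd v < 2 ^ cfst v /\ forall t, ~~ evicted v t].

Lemma recf_evicted f g : recf f -> recf g -> recf (fun n => evicted (f n) (g n)).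
Proof.
by move=> rf rg; rewrite /evicted /evict /covers; recf_tac; apply: recf_W; recf_tac.
Qed.

Lemma remaining_Pi1 : Pi_set 1 remaining.
Proof.
exists [set p | (csnd (cfst p) < 2 ^ cfst (cfst p)) && ~~ evicted (cfst p) (csnd p)].
  by apply: recf_computable; recf_tac; apply: recf_evicted; recf_tac.
move=> v /=; split=> [[lt h] y|h]; first by rewrite !cpairE lt h.
by split=> [|t]; [have := h 0|have := h t]; rewrite !cpairE => /andP[].
Qed.

Lemma covers_mono e b x t t' : t <= t' -> covers e b x t -> covers e b x t'.
Proof.
move=> tt /all_iotaP h; apply/all_iotaP => s /h /implyP c; apply/implyP => /c.
exact: W_mono.
Qed.

Lemma evicted_mono v t t' : t <= t' -> evicted v t -> evicted v t'.
Proof.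
move=> tt /has_iotaP[i lt h]; apply/has_iotaP; exists i => //; exact: leq_trans tt.
Qed.

Lemma remainingP v : remaining v <->
  csnd v < 2 ^ cfst v /\ forall e t, e < cfst v ->
    covers e (~~ bit (csnd v) e) (cfst v) t -> covers e (bit (csnd v) e) (cfst v) t.
Proof.
split=> -[lt h]; split=> //; [move=> e t ex c1|move=> t].
  apply: contraT => c2; case/negP: (h t.+1); apply/has_iotaP; exists t => //.
  by apply/has_iotaP; exists e => //; rewrite c1.
apply/negP => /has_iotaP[t' _ /has_iotaP[e ex /andP[c1]]].
by rewrite h.
Qed.

(** Bit [e] is 0 if the half with bit 0 is covered strictly before the other half, and 1 otherwise;
    no requirement then evicts the point. *)
Lemma remaining_block x : exists2 s, s < 2 ^ x & remaining (cpair x s).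
Proof.
pose f e := ~~ `[< exists t, covers e false x t && ~~ covers e true x t >].
have [s lt sE] := exists_bits f x; exists s => //.
apply/remainingP; rewrite !cpairE; split=> // e t ex; rewrite (sE _ ex) /f.
case: asboolP => /= [[t0 /andP[c0 c1]]|h] ct; last first.
  by apply: contraT => nc; case: h; exists t; rewrite ct.
case: (leqP t0 t) => tt; first exact: covers_mono tt c0.
by rewrite (covers_mono _ _ _ _ _ (ltnW tt) ct) in c1.
Qed.

Lemma finite_bounded (S : set nat) : finite_set S -> exists N, forall v, S v -> v < N.
Proof.
move=> /finite_seqP[l ->]; exists (\sum_(i <- l) i).+1 => v /= vl.
by rewrite ltnS (big_rem v) //= leq_addr.
Qed.

Lemma unbounded_infinite (S : set nat) (f : nat -> nat) :
  (forall n, exists2 v, S v & n <= f v) -> infinite_set S.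
Proof.
move=> h /(finite_image f) /finite_bounded[N hN].
have [v Sv] := h N; rewrite leqNgt hN //; by exists v.
Qed.

Lemma infinite_blocks (C : set nat) : infinite_set C ->
  (forall v, C v -> csnd v < 2 ^ cfst v) -> forall n, exists2 v, C v & n <= cfst v.
Proof.
move=> infC hC n; apply: contra_notP infC => h.
apply: (sub_finite_set (B := \bigcup_(x in `I_n) (cpair x @` `I_(2 ^ x)))).
  move=> v Cv; exists (cfst v) => /=.
    by rewrite ltnNge; apply/negP => le; apply: h; exists v.
  by exists (csnd v); [exact: hC|exact: cpair_surj].
by apply: bigcup_finite => // x _; exact: finite_image.
Qed.

Lemma remaining_infinite : infinite_set remaining.
Proof.
apply: (unbounded_infinite _ cfst) => n.
by have [s _ rs] := remaining_block n; exists (cpair n s); rewrite // cfst_pair.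
Qed.

Lemma block_split (C : set nat) e : C `<=` remaining ->
  (forall n, ~ C n <-> exists t, W e t n) ->
  forall v b, C v -> e < cfst v ->
  exists2 u, C u & cfst u = cfst v /\ bit (csnd u) e = b.
Proof.
move=> CA eP v b Cv ev; apply: contrapT => nex.
have notW t : ~~ W e t v by apply/negP => w; apply: (eP v).2 Cv; exists t.
have /remainingP[lt hv] := CA v Cv.
(* A covered half cannot contain [v], since [v] would then lie in the complement of [C]. *)
have inW b' t : covers e b' (cfst v) t -> bit (csnd v) e = b' -> False.
  move=> /all_iotaP /(_ _ lt) /implyP h /eqP /h.
  by rewrite cpair_surj (negPf (notW t)).
(* If no point of [C] in the block has bit [b], that whole finite half enters [W e] by a common
   stage. *)
have [t ct] : exists t, covers e b (cfst v) t.
  have [|s hs|t ht] := common_stage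
      (fun s t => (bit s e == b) ==> W e t (cpair (cfst v) s)) (2 ^ cfst v).
  - by move=> i t t' tt /implyP h; apply/implyP => /h; exact: W_mono.
  - case: (eqVneq (bit s e) b) => [sb|_]; last by exists 0.
    have [|t wt] := (eP (cpair (cfst v) s)).1; last by exists t.
    by move=> Cs; apply: nex; exists (cpair (cfst v) s); rewrite ?cpairE.
  - by exists t; apply/all_iotaP.
case: (eqVneq (bit (csnd v) e) b) => [|nb]; first exact: inW ct.
(* The point [v] lies in the other half; having survived, it has its own half covered as well. *)
apply: (inW (bit (csnd v) e) t) => //; apply: hv => //.
by rewrite (_ : ~~ bit (csnd v) e = b) //; move: nb; case: (bit _ _) (b) => [] [].
Qed.

Lemma no_Pi1_r_cohesive (C : set nat) :
  C `<=` remaining -> Pi_set 1 C -> ~ r_cohesive C.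
Proof.
move=> CA /Pi1_complement[e eP] [infC coh].
have split_inf b : infinite_set (C `&` [set v | bit (csnd v) e = b]).
  apply: (unbounded_infinite _ cfst) => n.
  (* The block must lie beyond [e] for the requirement to act on it, and at or beyond [n] for
     unboundedness. *)
  have [|v Cv le] := infinite_blocks C infC _ (maxn n e.+1).
    by move=> v /CA[].
  move: le; rewrite geq_max => /andP[nv ev].
  have [u Cu [uv ub]] := block_split C e CA eP v b Cv ev.
  by exists u; rewrite // uv.
have [||] := coh [set v | bit (csnd v) e].
- by apply: recf_computable; recf_tac.
- move=> fin; apply: (split_inf false); apply: sub_finite_set fin => v [Cv /= vb].
  by split=> //=; rewrite vb.
- move=> fin; apply: (split_inf true); apply: sub_finite_set fin => v [Cv /= vb].
  by split=> //=; rewrite vb; apply.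
Qed.

(** * The Delta_2 cohesive subset *)

Definition settles (b : nat -> bool) (P : Prop) : Prop :=
  exists t0, forall t, t0 <= t -> (b t <-> P).

Lemma settles_iff b P Q : (P <-> Q) -> settles b P -> settles b Q.
Proof. by move=> PQ [t0 h]; exists t0 => t /h ->. Qed.

Lemma settles_const (b : bool) : settles (fun=> b) b.
Proof. by exists 0. Qed.

(** An increasing Boolean sequence changes its value at most once. *)
Lemma settles_mono (b : nat -> bool) : (forall t t', t <= t' -> b t -> b t') ->
  settles b (exists t, b t).
Proof.
move=> mono; case: (pselect (exists t, b t)) => [[t bt]|nb].
  by exists t => t' le; split=> _; [exists t|exact: mono bt].
by exists 0 => t _; split=> // bt; exists t.
Qed.

Lemma settles_not b P : settles b P -> settles (fun t => ~~ b t) (~ P).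
Proof. by move=> [t0 h]; exists t0 => t /h <-; split=> /negP. Qed.

Lemma settles_and b c P Q :
  settles b P -> settles c Q -> settles (fun t => b t && c t) (P /\ Q).
Proof.
move=> [t0 h] [t1 k]; exists (maxn t0 t1) => t; rewrite geq_max => /andP[/h <- /k <-].
by split=> /andP.
Qed.

Lemma settles_has (b : nat -> nat -> bool) (P : nat -> Prop) n :
  (forall i, settles (b i) (P i)) ->
  settles (fun t => has (fun i => b i t) (iota 0 n)) (exists i, i < n /\ P i).
Proof.
move=> h.
suff [t0 ht] : exists t0, forall i, i < n -> forall t, t0 <= t -> (b i t <-> P i).
  exists t0 => t le; split=> [/has_iotaP[i lt /ht bi]|[i [lt Pi]]].
    by exists i; split=> //; exact: bi.
  by apply/has_iotaP; exists i => //; exact/ht.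
(* The [b i] need not be monotone, but being settled from [t0] on is monotone in [t0]. *)
have [i t t' le /asboolP pt|i _|t0 ht] := common_stage
    (fun i t0 => `[< forall t, t0 <= t -> (b i t <-> P i) >]) n.
- by apply/asboolP => u /(leq_trans le); exact: pt.
- by have [t0 ht] := h i; exists t0; exact/asboolP.
- by exists t0 => i /ht /asboolP.
Qed.

(** One direction of Shoenfield's limit lemma: the limit is true iff the approximation is eventually
    always true, and iff it is true arbitrarily late. *)
Lemma limit_Delta2 (P : set nat) (g : nat -> nat -> bool) :
  recf (fun p => g (cfst p) (csnd p)) -> (forall n, settles (g n) (P n)) ->
  Delta_set 2 P.
Proof.
move=> rg lim.
have comp : computable
    [set q | g (cfst (cfst q)) (csnd (cfst q) + csnd q)].
  apply/recf_computable/recf_ext/(recf_comp _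
    (fun q => cpair (cfst (cfst q)) (csnd (cfst q) + csnd q)) rg); last by recf_tac.
  by move=> q; rewrite !cpairE.
split.
- exists [set p | forall k, g (cfst p) (csnd p + k)].
    by exists [set q | g (cfst (cfst q)) (csnd (cfst q) + csnd q)] => // p /=;
      split=> h k; have := h k; rewrite !cpairE.
  move=> n /=; have [t0 h] := lim n; split=> [Pn|[t]].
    by exists t0 => k; rewrite !cpairE; apply/h; rewrite // leq_addr.
  by move=> /(_ t0); rewrite !cpairE => /h; apply; exact: leq_addl.
- exists [set p | exists k, g (cfst p) (csnd p + k)].
    by exists [set q | g (cfst (cfst q)) (csnd (cfst q) + csnd q)] => // p /=;
      split=> -[k h]; exists k; move: h; rewrite !cpairE.
  move=> n /=; have [t0 h] := lim n; split=> [Pn t|/(_ t0)[k]].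
    by exists t0; rewrite !cpairE; apply/h; rewrite // leq_addl.
  by rewrite !cpairE => /h; apply; exact: leq_addr.
Qed.

(** * Approximated states of points, blocks and tails *)

Fixpoint state (t n v : nat) : nat :=
  if n is k.+1 then W k t v + (state t k v).*2 else 0.

(** Bounding the least state over the unevicted points makes this monotone in [t]: evictions and
    growing states only raise that minimum. *)
Definition block_ge (n k x t : nat) : bool :=
  all (fun s => evicted (cpair x s) t || (k <= state t n (cpair x s)))
    (iota 0 (2 ^ x)).

Definition tail_ge (n k t : nat) : bool :=
  has (fun x => (n <= x) && block_ge n k x t) (iota 0 t).

Lemma recf_state f g h : recf f -> recf g -> recf h ->
  recf (fun n => state (f n) (g n) (h n)).
Proof.
move=> rf rg rh.
apply: (recf_ext (fun n => prec 0 (fun k r => W k (f n) (h n) + (r + r)) (g n))).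
  by move=> n; elim: (g n) => //= k ->; rewrite addnn.
by recf_tac; apply: recf_W; recf_tac.
Qed.

Ltac recf_block :=
  lazymatch goal with
  | |- recf (fun n => nat_of_bool (evicted (@?f n) (@?g n))) =>
      apply: (recf_evicted f g)
  | |- recf (fun n => state (@?f n) (@?g n) (@?h n)) => apply: (recf_state f g h)
  | |- _ => recf_arith
  end.

Ltac recf_user ::= recf_block.

Lemma state_mono t t' n v : t <= t' -> state t n v <= state t' n v.
Proof.
move=> tt; elim: n => //= k IH; rewrite leq_add ?leq_double //.
by case wt: (W k t v); rewrite // (W_mono _ _ _ _ tt wt).
Qed.

Lemma state_lt t n v : state t n v < 2 ^ n.
Proof.
elim: n => //= n IH; rewrite expnS mul2n -ltn_half_double.
by rewrite half_bit_double.
Qed.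

(** Later indices give less significant digits, so dividing by [2 ^ d] forgets the last [d] sets. *)
Lemma state_div t m d v : state t (m + d) v %/ 2 ^ d = state t m v.
Proof.
elim: d => [|d IH]; first by rewrite addn0 divn1.
by rewrite addnS /= expnS divnMA divn2 half_bit_double IH.
Qed.

Lemma block_ge_mono n k x t t' : t <= t' -> block_ge n k x t -> block_ge n k x t'.
Proof.
move=> tt /all_iotaP h; apply/all_iotaP => s /h /orP[ev|le]; apply/orP.
  by left; exact: evicted_mono ev.
by right; apply: leq_trans le _; exact: state_mono.
Qed.

Lemma tail_ge_mono n k t t' : t <= t' -> tail_ge n k t -> tail_ge n k t'.
Proof.
move=> tt /has_iotaP[x xt /andP[nx h]]; apply/has_iotaP.
by exists x; [exact: leq_trans tt|rewrite nx (block_ge_mono _ _ _ _ _ tt h)].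
Qed.

Lemma tail_geP n k :
  (exists t, tail_ge n k t) <-> exists2 x, n <= x & exists t, block_ge n k x t.
Proof.
split=> [[t /has_iotaP[x _ /andP[nx h]]]|[x nx [t h]]].
  by exists x => //; exists t.
(* The stage must exceed [x], as [tail_ge] only inspects blocks below its stage. *)
exists (maxn x.+1 t); apply/has_iotaP; exists x; first exact: leq_maxl.
by rewrite nx (block_ge_mono _ _ _ _ _ _ h) // leq_maxr.
Qed.

Lemma block_ge_div m d j x t : block_ge m j x t = block_ge (m + d) (j * 2 ^ d) x t.
Proof.
by apply: eq_all => s; rewrite -(state_div t m d) leq_divRL // expn_gt0.
Qed.

Lemma block_ge_weaken n k k' x t : k <= k' -> block_ge n k' x t -> block_ge n k x t.
Proof.
move=> kk /all_iotaP h; apply/all_iotaP => s /h /orP[->//|le].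
by rewrite (leq_trans kk le) orbT.
Qed.

(** Each block keeps a point, so the lower bound is compared with the state of an actual point. *)
Lemma block_ge_lt n k x t : block_ge n k x t -> k < 2 ^ n.
Proof.
have [s sx [_ h]] := remaining_block x.
move=> /all_iotaP /(_ s sx); rewrite (negPf (h t)) => le.
exact: leq_ltn_trans le (state_lt _ _ _).
Qed.

(** By compactness: if every point of the finite block were eventually evicted or above [k], one
    stage would serve for all of them. *)
Lemma state_witness n k x : ~ (exists t, block_ge n k.+1 x t) ->
  exists s, [/\ s < 2 ^ x, remaining (cpair x s)
    & forall t, state t n (cpair x s) <= k].
Proof.
move=> nge; apply: contrapT => nex; apply: nge.
have [i t t' tt /orP[ev|le]|s sx|t h] := common_stage (fun s t =>
    evicted (cpair x s) t || (k < state t n (cpair x s))) (2 ^ x).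
- by rewrite (evicted_mono _ _ _ tt ev).
- by rewrite (leq_trans le (state_mono _ _ _ _ tt)) orbT.
- apply: contrapT => nt; apply: nex; exists s; split=> // [|t].
    split=> [|t]; first by rewrite !cpairE.
    by apply/negP => ev; apply: nt; exists t; rewrite ev.
  by rewrite leqNgt; apply/negP => lt; apply: nt; exists t; rewrite lt orbT.
- by exists t; apply/all_iotaP.
Qed.

(** * Leading blocks and the points chosen from them *)

Definition leader (n k x : nat) : Prop :=
  (exists t, block_ge n k x t) /\ ~ (exists t, tail_ge n k.+1 t) /\
  ~ (exists y, y < x /\ n <= y /\ exists t, block_ge n k y t).

Definition chosen_at (v n k : nat) : Prop :=
  leader n k (cfst v) /\ ~ (exists t, k < state t n v).

(** Bounding [n] and [k] makes the approximation a finite search; the bound on [k] holds for every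
    leader by [block_ge_lt]. *)
Definition chosen : set nat :=
  [set v | remaining v /\
    exists n, n < (cfst v).+1 /\ exists k, k < 2 ^ n /\ chosen_at v n k].

Lemma chosen_Delta2 : Delta_set 2 chosen.
Proof.
apply: (limit_Delta2 _ (fun v t =>
  ((csnd v < 2 ^ cfst v) && ~~ evicted v t) &&
  has (fun n => has (fun k =>
    (block_ge n k (cfst v) t && (~~ tail_ge n k.+1 t &&
      ~~ has (fun y => (n <= y) && block_ge n k y t) (iota 0 (cfst v)))) &&
    ~~ (k < state t n v)) (iota 0 (2 ^ n))) (iota 0 (cfst v).+1))).
  by rewrite /tail_ge /block_ge; recf_tac.
have block n k x : settles (block_ge n k x) (exists t, block_ge n k x t).
  by apply: settles_mono => t t'; exact: block_ge_mono.
move=> v; apply: settles_and.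
  apply: settles_iff (settles_and _ _ _ _ (settles_const _)
    (settles_not _ _ (settles_mono _ (evicted_mono v)))).
  by split=> -[lt h]; split=> //;
    [move=> t; apply/negP => ev; apply: h; exists t|move=> [t]; exact/negP].
apply: settles_has => n; apply: settles_has => k.
apply: settles_and; first apply: settles_and => //; first apply: settles_and.
- by apply/settles_not/settles_mono => t t'; exact: tail_ge_mono.
- by apply/settles_not/settles_has => y; apply: settles_and => //; exact: settles_const.
- apply/settles_not/settles_mono => t t' tt lt.
  exact: leq_trans lt (state_mono _ _ _ _ tt).
Qed.

Lemma leader_exists n : exists k x, n <= x /\ leader n k x.
Proof.
pose p k := `[< exists2 x, n <= x & exists t, block_ge n k x t >].
have p0 : exists k, p k.
  exists 0; apply/asboolP; exists n => //; exists 0.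
  by apply/all_iotaP => s; rewrite orbT.
have pb k : p k -> k <= 2 ^ n.
  by move=> /asboolP[x _ [t /block_ge_lt/ltnW]].
(* The maximum exists because [n]-states stay below [2 ^ n]; the first block attaining it is the
   leader. *)
case: (ex_maxnP p0 pb) => k /asboolP[x0 nx0 ge0] max.
pose q x := `[< n <= x /\ exists t, block_ge n k x t >].
have q0 : exists x, q x by exists x0; apply/asboolP.
case: (ex_minnP q0) => x /asboolP[nx ge] min.
exists k, x; split=> //; split=> //; split.
  by move=> /tail_geP h; have := max k.+1; rewrite ltnn => /(_ (asboolT h)).
by move=> [y [yx h]]; have := min y (asboolT h); rewrite leqNgt yx.
Qed.

Lemma chosen_infinite : infinite_set chosen.
Proof.
apply: (unbounded_infinite _ cfst) => n.
have [k [x [nx lead]]] := leader_exists n.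
have [[t ge] [ntail _]] := lead.
(* Maximality of [k] over the tail keeps the leading block from reaching [k.+1]. *)
have [|s [sx rem st]] := state_witness n k x.
  by move=> h; apply: ntail; apply/tail_geP; exists x.
exists (cpair x s); last by rewrite cfst_pair.
split=> //; exists n; rewrite cfst_pair ltnS; split=> //.
exists k; split; first exact: block_ge_lt ge.
split; first by rewrite cfst_pair.
by move=> [u]; rewrite ltnNge st.
Qed.

Lemma leader_unique n k x k' x' :
  n <= x -> n <= x' -> leader n k x -> leader n k' x' -> x = x'.
Proof.
move=> nx nx' [ge [nt nl]] [ge' [nt' nl']].
have le a b y : n <= y -> ~ (exists t, tail_ge n a.+1 t) ->
    (exists t, block_ge n b y t) -> b <= a.
  move=> ny h [t g]; rewrite leqNgt; apply/negP => ab; apply: h.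
  by apply/tail_geP; exists y => //; exists t; exact: block_ge_weaken g.
have E : k = k'.
  by apply/eqP; rewrite eqn_leq (le _ _ _ nx nt' ge) (le _ _ _ nx' nt ge').
subst k'; case: (ltngtP x x') => // lt.
  by case: nl'; exists x.
by case: nl; exists x'.
Qed.

(** All these points lie in the unique leading block for [n], so any finite range of [n] may be
    ignored for cohesiveness. *)
Lemma chosen_at_finite n :
  finite_set [set v | remaining v /\ n <= cfst v /\ exists k, chosen_at v n k].
Proof.
have [k [x [nx lead]]] := leader_exists n.
apply: (sub_finite_set (B := cpair x @` `I_(2 ^ x))); last exact: finite_image.
move=> v [[lt _] [nv [k' [lead' _]]]].
have E := leader_unique _ _ _ _ _ nx nv lead lead'.
by exists (csnd v); rewrite /= E // cpair_surj.
Qed.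

(** The block bound gives [k] as an eventual lower bound for the state and the choice of [v] gives
    it as an upper bound; truncation then yields the [m]-state. *)
Lemma chosen_state v m d k : remaining v -> m + d <= cfst v ->
  chosen_at v (m + d) k -> exists t0, forall t, t0 <= t -> state t m v = k %/ 2 ^ d.
Proof.
move=> [lt h] nv [[[t0 ge] _] st]; exists t0 => t le.
rewrite -(state_div t m d); congr (_ %/ _); apply/eqP; rewrite eqn_leq.
apply/andP; split; first by rewrite leqNgt; apply/negP => kt; apply: st; exists t.
have /all_iotaP := block_ge_mono _ _ _ _ _ le ge.
by move=> /(_ _ lt); rewrite cpair_surj (negPf (h t)).
Qed.

(** Since earlier digits dominate, truncating the maximal long state of a tail gives its maximal
    [m]-state. *)
Lemma leader_tail m d k x j : m + d <= x -> leader (m + d) k x ->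
  (j <= k %/ 2 ^ d) <-> exists2 y, m + d <= y & exists t, block_ge m j y t.
Proof.
move=> nx [[t ge] [nt _]]; rewrite leq_divRL ?expn_gt0 //; split=> [le|[y ny [u]]].
  by exists x => //; exists t; rewrite (block_ge_div m d); exact: block_ge_weaken ge.
rewrite (block_ge_div m d) => h; rewrite leqNgt; apply/negP => lt; apply: nt.
by apply/tail_geP; exists y => //; exists u; exact: block_ge_weaken h.
Qed.

(** Here [q] is the largest value that the least [m]-states of blocks reach in every tail; beyond
    some [N] no block reaches [q.+1], so truncated leaders equal [q]. *)
Lemma eventual_state m : exists q N, forall v n k,
  remaining v -> N <= n -> n <= cfst v -> chosen_at v n k ->
  exists t0, forall t, t0 <= t -> state t m v = q.
Proof.
pose ge n j := exists2 y, n <= y & exists t, block_ge m j y t.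
pose p j := `[< forall n, ge n j >].
have p0 : exists j, p j.
  exists 0; apply/asboolP => n; exists n => //; exists 0.
  by apply/all_iotaP => s; rewrite orbT.
have pb j : p j -> j <= 2 ^ m.
  by move=> /asboolP/(_ 0)[y _ [t /block_ge_lt/ltnW]].
case: (ex_maxnP p0 pb) => q /asboolP geq max.
have [N nN] : exists N, ~ ge N q.+1.
  by apply/existsNP => h; have := max q.+1 (asboolT h); rewrite ltnn.
exists q, (maxn m N) => v n k rem; rewrite geq_max => /andP[mn Nn] nv ch.
move: nv ch; rewrite -(subnKC mn) => nv ch.
have [t0 ht] := chosen_state _ _ _ _ rem nv ch.
exists t0 => t /ht ->; have tailE := leader_tail m (n - m) k _ _ nv ch.1.
apply/eqP; rewrite eqn_leq (tailE q).2 ?andbT; last exact: geq.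
rewrite leqNgt; apply/negP => /tailE[y ny h]; apply: nN; exists y => //.
by apply: leq_trans ny; rewrite subnKC.
Qed.

Lemma chosen_cohesive : cohesive chosen.
Proof.
split; first exact: chosen_infinite.
move=> V /ce_index[e eV].
(* With [e.+1] digits, membership in [W e] is the last digit, that is, the parity of the state. *)
have [q [N h]] := eventual_state e.+1.
(* Points chosen for some [n] below [N] are the finitely many possible exceptions. *)
have fin : finite_set (\bigcup_(n in `I_N)
    [set v | remaining v /\ n <= cfst v /\ exists k, chosen_at v n k]).
  by apply: bigcup_finite => // n _; exact: chosen_at_finite.
have dec v : chosen v -> ~ (\bigcup_(n in `I_N)
    [set v | remaining v /\ n <= cfst v /\ exists k, chosen_at v n k]) v ->
    (V v <-> odd q).
  move=> [rem [n [nv [k [_ ch]]]]] notin; rewrite ltnS in nv.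
  have Nn : N <= n.
    rewrite leqNgt; apply/negP => lt; apply: notin.
    by exists n => //; split=> //; split=> //; exists k.
  have [t0 ht] := h v n k rem Nn nv ch.
  have E t : t0 <= t -> W e t v = odd q.
    by move=> /ht <- /=; rewrite oddD odd_double addbF oddb.
  rewrite eV -(E t0) //; split=> [[t wt]|w]; last by exists t0.
  rewrite (E t0) // -(E (maxn t0 t)) ?leq_maxl //.
  by apply: W_mono wt; exact: leq_maxr.
case oq: (odd q); [left|right]; apply: sub_finite_set fin => v [Cv nV];
  apply: contrapT => /(dec v Cv); rewrite oq => E; apply: nV.
  exact/E.
by move=> /E.
Qed.

Theorem proposition3p8 :
  exists A : set nat,
    [/\ infinite_set A,
        Pi_set 1 A,
        ~ (exists C : set nat, [/\ C `<=` A, Pi_set 1 C & r_cohesive C])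
      & exists C : set nat, [/\ C `<=` A, Delta_set 2 C & cohesive C]].
Proof.
exists remaining; split; [exact: remaining_infinite|exact: remaining_Pi1| |].
  by move=> [C [CA CP]]; exact: no_Pi1_r_cohesive.
exists chosen; split; [by move=> v []|exact: chosen_Delta2|exact: chosen_cohesive].
Qed.
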